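(* Let $k$ be an infinite field, $n\ge1$, $0\le d\le n$, and let $<$ be a term order on $k[X_1,\ldots,X_n]$ with $X_1<\cdots<X_n$. Let $A\subseteq k^n$ be a finite union of pairwise distinct affine $d$-planes (its irreducible components). For each $J\subseteq\{1,\ldots,n\}$ with $\#J=d$, let $m_J$ be the number of irreducible components of $A$ whose minimal free variables are $\{X_j;\ j\in J\}$. Then for every such $J$, the number of $d$-planes in $D(A)$ parallel to $\bigoplus_{j\in J}\mathbb{N}e_j$ equals $m_J$. (In particular the total number of $d$-planes in $D(A)$ equals the number of irreducible components of $A$.)
   Context: $k[X]=k[X_1,\ldots,X_n]$; $e_i$ denotes the $i$-th standard basis vector of $\mathbb{N}^n$. For $A\subseteq k^n$, $I(A)$ is the ideal of all polynomials vanishing on $A$. For nonzero $f\in k[X]$, ${\rm LE}(f)\in\mathbb{N}^n$ is the exponent of the leading monomial of $f$ with respect to $<$. $C(A)=\{{\rm LE}(f);\ 0\ne f\in I(A)\}$ and the standard set is $D(A)=\mathbb{N}^n\setminus C(A)$. For a subset $\delta\subseteq\mathbb{N}^n$, a $d$-plane in $\delta$ is a subset of $\delta$ of the form $\gamma+\bigoplus_{j\in J}\mathbb{N}e_j$ where $J\subseteq\{1,\ldots,n\}$, $\#J=d$, $\gamma\in\mathbb{N}^n$ and $\gamma_j=0$ for all $j\in J$; it is said to be parallel to $\bigoplus_{j\in J}\mathbb{N}e_j$. An affine $d$-plane of $k^n$ is a translate of a $d$-dimensional linear subspace. For $\#J=d$, $\{X_j;\ j\in J\}$ is a set of free variables of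 an affine $d$-plane $A'$ if the coordinate projection $A'\to k^J$ is a bijection; they are the minimal free variables of $A'$ if, in addition, for every $j\in J$ there is no $i\notin J$ with $i<j$ such that $\{X_j;\ j\in (J\setminus\{j\})\cup\{i\}\}$ is a set of free variables of $A'$. *)

(* Defs.v *)
From HB Require Import structures.
From mathcomp Require Import all_boot all_order all_algebra.
Set Implicit Arguments. Unset Strict Implicit. Unset Printing Implicit Defensive.
Import Order.TTheory GRing.Theory Num.Theory.
Local Open Scope ring_scope.

Definition exps (n : nat) := {ffun 'I_n -> nat}.
Definition expadd n (a b : exps n) : exps n := [ffun i => (a i + b i)%N].
Definition exp0 n : exps n := [ffun _ => 0%N].
Definition expe n (i : 'I_n) : exps n := [ffun j => if j == i then 1%N else 0%N].

Definition term_order n (le : rel (exps n)) : Prop :=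
  [/\ reflexive le, transitive le, antisymmetric le, total le &
      (forall a, le (exp0 n) a) /\
      (forall a b c, le a b -> le (expadd a c) (expadd b c))].

Definition vars_increasing n (le : rel (exps n)) : Prop :=
  forall i j : 'I_n, (i < j)%N -> le (expe i) (expe j).

Definition mpoly (k : fieldType) (n : nat) := seq (exps n * k).

Definition mcoef (k : fieldType) n (f : mpoly k n) (a : exps n) : k :=
  \sum_(t <- f | t.1 == a) t.2.

Definition meval (k : fieldType) n (f : mpoly k n) (x : 'rV[k]_n) : k :=
  \sum_(t <- f) t.2 * \prod_(i < n) x 0 i ^+ (t.1 i).

Definition is_LE (k : fieldType) n (le : rel (exps n)) (f : mpoly k n) (a : exps n) :=
  mcoef f a != 0 /\ forall b, mcoef f b != 0 -> le b a.

Definition in_ideal_of (k : fieldType) n (A : 'rV[k]_n -> Prop) (f : mpoly k n) :=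
  forall x, A x -> meval f x = 0.

Definition in_C (k : fieldType) n (le : rel (exps n)) (A : 'rV[k]_n -> Prop) a :=
  exists f : mpoly k n, in_ideal_of A f /\ is_LE le f a.
Definition in_D (k : fieldType) n (le : rel (exps n)) (A : 'rV[k]_n -> Prop) a :=
  ~ in_C le A a.

(* gamma + (+)_{j in J} N e_j is a d-plane contained in delta (with gamma_j = 0 on J) *)
Definition dplane_in n (delta : exps n -> Prop) (J : {set 'I_n}) (g : exps n) :=
  (forall j, j \in J -> g j = 0%N) /\
  forall c : exps n, (forall i, i \notin J -> c i = 0%N) -> delta (expadd g c).

(* affine d-plane: a + rowspace(M), M : d x n of full row rank d *)
Definition aplane (k : fieldType) d n := ('rV[k]_n * 'M[k]_(d, n))%type.
Definition in_aplane (k : fieldType) d n (P : aplane k d n) (x : 'rV[k]_n) : bool :=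
  (x - P.1 <= P.2)%MS.
Definition is_aplane (k : fieldType) d n (P : aplane k d n) : Prop := row_free P.2.

(* {X_j ; j in J} is a set of free variables of the affine plane P:
   the coordinate projection P -> k^J is bijective *)
Definition free_vars (k : fieldType) d n (P : aplane k d n) (J : {set 'I_n}) :=
  forall y : 'rV[k]_n, exists! x : 'rV[k]_n,
    in_aplane P x /\ forall j, j \in J -> x 0 j = y 0 j.

Definition min_free_vars (k : fieldType) d n (P : aplane k d n) (J : {set 'I_n}) :=
  free_vars P J /\
  forall j i : 'I_n, j \in J -> i \notin J -> (i < j)%N ->
    ~ free_vars P (i |: (J :\ j)).

Definition has_card (T : eqType) (P : T -> Prop) (m : nat) :=
  exists s : seq T, [/\ uniq s, (forall x, x \in s <-> P x) & size s = m].

(* Main.v *)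
Require Import Defs.
From HB Require Import structures.
From mathcomp Require Import all_boot all_order all_algebra.
From mathcomp Require Import mpoly zify.
From Stdlib Require Import Classical.
Import Order.TTheory GRing.Theory Num.Theory.
Local Open Scope ring_scope.
Set Implicit Arguments. Unset Strict Implicit. Unset Printing Implicit Defensive.

(** A plane P with minimal free variables X_J is the graph of affine functions
    X_i = L_{P,i}(X_J), i \notin J, in which only X_j with j < i occur; let phi_P
    denote the substitution X_i := L_{P,i}. A plane with any other minimal free
    variables carries an affine polynomial with leading exponent in N^J, so
    multiplying by such polynomials shows that only the m planes of type J
    matter. Call g \in N^{J^c} full if g + N^J is contained in D(A).
    - At most m exponents are full: otherwise the vectors (phi_P(X^g))_P are
      linearly dependent over k[X_J], and a dependency sum_g r_g X^g lies in
      I(A) with leading exponent in g + N^J for some full g.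
    - At least m are full: otherwise some u <> 0 makes
      phi(f) = sum_P u_P phi_P(f) vanish on X^g for all full g. Choose a pair
      (g, t), t an exponent of phi(X^g), with t - g maximal; the relations
      prod_P (X_i - L_{P,i}) = 0 reduce this to finitely many g. Then g is not
      full, so some f in I(A) has leading exponent g + c with c \in N^J, and the
      exponent t + c cannot cancel in phi(f) = 0. *)

(** * Finite lists, linear systems over a domain, nonvanishing of polynomials *)

Lemma exists_max_seq (T : eqType) (r : rel T) (s : seq T) :
  total r -> transitive r -> s != [::] ->
  exists2 x, x \in s & forall y, y \in s -> r y x.
Proof.
move=> rT rtr; elim: s => // x s IH _.
have rr y : r y y by case/orP: (rT y y).
case: (eqVneq s [::]) => [->|/IH [y ys ymax]].
  by exists x; rewrite ?mem_head // => y; rewrite inE => /eqP ->.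
case/orP: (rT x y) => xy.
- by exists y; rewrite ?inE ?ys ?orbT // => z; rewrite inE => /predU1P[->|/ymax].
- exists x; rewrite ?mem_head // => z; rewrite inE => /predU1P[->//|/ymax zy].
  exact: rtr xy.
Qed.

Lemma seq_comprehension (T : eqType) (s : seq T) (P : T -> Prop) :
  uniq s -> exists2 t, uniq t & forall x, x \in t <-> x \in s /\ P x.
Proof.
elim: s => [|x s IH] /=; first by exists [::] => // x; split=> [|[]].
case/andP=> xs /IH [t ut tP]; case: (classic (P x)) => Px.
- exists (x :: t) => [|y].
    by rewrite /= ut andbT; apply/negP=> /tP[]; rewrite (negPf xs).
  rewrite !inE; split=> [/predU1P[->|/tP[-> ?]]|[/predU1P[->|ys] Py]].
  + by rewrite eqxx.
  + by rewrite orbT.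
  + by rewrite eqxx.
  + by apply/orP; right; apply/tP.
- exists t => // y; rewrite tP inE; split=> [[-> ?]|[/predU1P[->|]]] //.
  by rewrite orbT.
Qed.

(** Elements are collected one at a time up to [m] of them; one still missing would give a list of
    length [m.+1], against the upper bound. *)
Lemma has_card_squeeze (T : eqType) (P : T -> Prop) (m : nat) :
  (forall s, uniq s -> (forall x, x \in s -> P x) -> (size s <= m)%N) ->
  (forall s, (size s < m)%N -> exists2 x, P x & x \notin s) ->
  has_card P m.
Proof.
move=> ub lb.
have H r : (r <= m)%N ->
    exists s, [/\ uniq s, forall x, x \in s -> P x & size s = r].
  elim: r => [|r IH] rm; first by exists [::].
  have [s [us sP sr]] := IH (ltnW rm).
  have [|x Px xs] := lb s; first by rewrite sr.
  exists (x :: s); split => /=; [by rewrite xs|move=> y|by rewrite sr].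
  by rewrite inE => /predU1P[->|/sP].
have [s [us sP sm]] := H m (leqnn m).
exists s; split=> // x; split=> [/sP //|Px].
apply/negPn/negP=> xs; have := ub (x :: s).
rewrite /= xs us sm ltnn => /(_ isT); suff H' : forall y, y \in x :: s -> P y by move/(_ H').
by move=> y; rewrite inE => /predU1P[->|/sP].
Qed.

(** Elimination without division: the pivot row is cross-multiplied into the other rows, so the
    solution lies in the domain itself. *)
Lemma underdetermined_system (R : idomainType) (q p : nat)
    (f : 'I_p -> 'I_q -> R) :
  (q < p)%N ->
  exists u : 'I_p -> R, (exists i, u i != 0) /\
    forall j, \sum_i u i * f i j = 0.
Proof.
elim: q p f => [|q IH] p f; case: p f => // p f qp.
  by exists (fun=> 1); split=> [|[]//]; exists ord0; apply: oner_neq0.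
case: (boolP [exists i, f i ord0 != 0]) => [/existsP[i0 fi0]|]; last first.
  move/existsPn=> f0; have [u [nu uP]] := IH _ (fun i j => f i (fintype.lift ord0 j)) (ltnW qp).
  exists u; split=> // j; case: (unliftP ord0 j) => [j' ->|->]; first exact: uP.
  by rewrite big1 // => i _; have /negPn/eqP -> := f0 i; rewrite mulr0.
have [v [[i1 vi1] vP]] := IH p (fun i j =>
  f i0 ord0 * f (fintype.lift i0 i) (fintype.lift ord0 j) -
  f (fintype.lift i0 i) ord0 * f i0 (fintype.lift ord0 j)) qp.
(* The other unknowns are scaled by the pivot; the value at [i0] makes column [ord0] cancel. *)
pose u i := if fintype.unlift i0 i is Some i' then v i' * f i0 ord0
            else - \sum_i' v i' * f (fintype.lift i0 i') ord0.
have sumu j : \sum_i u i * f i j = \sum_i' v i' *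
   (f i0 ord0 * f (fintype.lift i0 i') j - f (fintype.lift i0 i') ord0 * f i0 j).
  rewrite (bigD1 i0) //= /u unlift_none mulNr mulr_suml addrC.
  have -> : \sum_(i | i != i0) u i * f i j =
      \sum_i' v i' * f i0 ord0 * f (fintype.lift i0 i') j.
    rewrite (reindex_omap (fintype.lift i0) (fintype.unlift i0)) /=; last first.
      by move=> i; case: (unliftP i0 i) => [j' ei|ei] ni; [rewrite ei|rewrite ei eqxx in ni].
    apply: eq_big => i; first by rewrite liftK eqxx andbT eq_sym neq_lift.
    by rewrite /u liftK.
  rewrite -sumrB; apply: eq_bigr => i _.
  by rewrite mulrBr !mulrA.
exists u; split; first by exists (fintype.lift i0 i1); rewrite /u liftK mulf_neq0.
move=> j; rewrite sumu; case: (unliftP ord0 j) => [j' ->|->]; first exact: vP.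
by rewrite big1 // => i _; rewrite [X in X - _]mulrC subrr mulr0.
Qed.

Lemma digits_inj (N n : nat) (a b : 'I_n -> nat) :
  (forall i, a i < N)%N -> (forall i, b i < N)%N ->
  (\sum_i a i * N ^ i)%N = (\sum_i b i * N ^ i)%N -> a =1 b.
Proof.
elim: n a b => [|n IH] a b aN bN; first by move=> _ [].
have E (c : 'I_n.+1 -> nat) : (\sum_i c i * N ^ i)%N =
   ((\sum_(i < n) c (fintype.lift ord0 i) * N ^ i) * N + c ord0)%N.
  rewrite big_ord_recl /= expn0 muln1 addnC; congr (_ + _)%N.
  by rewrite big_distrl; apply: eq_bigr => i _; rewrite /bump /= add1n expnSr mulnA.
rewrite !E => eqab.
have N0 : (0 < N)%N by apply: leq_ltn_trans (aN ord0).
have e0 : a ord0 = b ord0.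
  by have := congr1 (modn^~ N) eqab; rewrite /= !modnMDl !modn_small.
move: eqab; rewrite e0 => /addIn /eqP; rewrite eqn_pmul2r // => /eqP.
move/(IH _ _ (fun i => aN _) (fun i => bN _)) => e1 i.
by case: (unliftP ord0 i) => [j ->|->].
Qed.

(* Kronecker substitution [X_i := T ^ (N ^ i)] reduces to one variable. *)
Lemma mpoly_nonvanishing (k : fieldType) (n : nat) (p : {mpoly k[n]}) :
  (forall s : seq k, exists x : k, x \notin s) ->
  p != 0 -> exists y : 'I_n -> k, p.@[y] != 0.
Proof.
(* [msize p] exceeds the degree of every monomial of [p], so exponents are digits in base [N] and
   [code] is injective on the support. *)
move=> kinf p0; pose N := msize p.
pose code (m : 'X_{1..n}) := (\sum_i m i * N ^ i)%N.
pose P : {poly k} := \sum_(m <- msupp p) p@_m *: 'X^(code m).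
have codeI m m' : m \in msupp p -> m' \in msupp p -> code m = code m' -> m = m'.
  move=> ms m's e; apply/mnmP; apply: digits_inj e => i.
  - apply: leq_ltn_trans (msize_mdeg_lt ms); rewrite mdegE (bigD1 i) //=; exact: leq_addr.
  - apply: leq_ltn_trans (msize_mdeg_lt m's); rewrite mdegE (bigD1 i) //=; exact: leq_addr.
have P0 : P != 0.
  have [m ms] : exists m, m \in msupp p.
    case E: (msupp p) => [|m s]; last by exists m; rewrite mem_head.
    by move/msuppnil0: E p0 => ->; rewrite eqxx.
  apply/eqP=> /(congr1 (fun q : {poly k} => q`_(code m))).
  rewrite coef0 coef_sum (bigD1_seq m) ?msupp_uniq //= coefZ coefXn eqxx mulr1.
  rewrite big_seq_cond big1 ?addr0 => [|m' /andP[m's m'm]].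
    by move/eqP; rewrite mcoeff_eq0 ms.
  rewrite coefZ coefXn; case: eqP => [/codeI e|]; last by rewrite mulr0.
  by rewrite e ?eqxx // in m'm.
(* If no finite list held all roots, there would be root lists of every length, against the degree
   bound. *)
have [r rP] : exists r : seq k, forall x, root P x -> x \in r.
  apply: NNPP => H.
  have K c : exists s, [/\ uniq s, all (root P) s & size s = c].
    elim: c => [|c [s [us rs sc]]]; first by exists [::].
    apply: NNPP => H'; apply: H; exists s => x rx.
    apply/negPn/negP => xs; apply: H'; exists (x :: s).
    by rewrite /= xs us rx rs sc.
  have [s [us rs sc]] := K (size P).
  by have := max_poly_roots P0 rs us; rewrite sc ltnn.
have [x xr] := kinf r.
exists (fun i => x ^+ (N ^ i)).
have -> : p.@[fun i => x ^+ (N ^ i)] = P.[x].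
  rewrite mevalE horner_sum; apply: eq_bigr => m _.
  rewrite hornerZ hornerXn; congr (_ * _); rewrite /code.
  rewrite -prodrXr; apply: eq_bigr => i _; by rewrite -exprM mulnC.
by apply/negP=> /rP; apply/negP.
Qed.

(** * Supports of polynomials, and exponents split along [J] *)

Definition supp_in (R : nzRingType) n (S : pred 'X_{1..n}) (p : {mpoly R[n]}) :=
  forall a, a \in msupp p -> S a.

Section SuppIn.
Variables (R : nzRingType) (n : nat).
Implicit Types (S T U : pred 'X_{1..n}) (p q : {mpoly R[n]}).

Lemma supp_in0 S : supp_in S (0 : {mpoly R[n]}).
Proof. by move=> a; rewrite msupp0. Qed.

Lemma supp_inD S p q : supp_in S p -> supp_in S q -> supp_in S (p + q).
Proof. by move=> Sp Sq a /msuppD_le; rewrite mem_cat => /orP[/Sp|/Sq]. Qed.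

Lemma supp_inN S p : supp_in S p -> supp_in S (- p).
Proof. by move=> Sp a; rewrite (perm_mem (msuppN p)) => /Sp. Qed.

Lemma supp_inZ S c p : supp_in S p -> supp_in S (c *: p).
Proof. by move=> Sp a /msuppZ_le /Sp. Qed.

Lemma supp_in_sum I (r : seq I) (P : pred I) (F : I -> {mpoly R[n]}) S :
  (forall i, P i -> supp_in S (F i)) -> supp_in S (\sum_(i <- r | P i) F i).
Proof.
move=> H; elim/big_ind: _ => [|p q|i Pi]; [exact: supp_in0|exact: supp_inD|exact: H].
Qed.

Lemma supp_inM S T U p q :
  (forall a b, S a -> T b -> U (a + b)%MM) ->
  supp_in S p -> supp_in T q -> supp_in U (p * q).
Proof.
move=> STU Sp Tq a /msuppM_le /allpairsP[[b c] /= [/Sp Sb /Tq Tc ->]]; exact: STU.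
Qed.

Lemma supp_inX S a : S a -> supp_in S ('X_[a] : {mpoly R[n]}).
Proof. by move=> Sa b; rewrite msuppX inE => /eqP ->. Qed.

Lemma supp_inC S c : S 0%MM -> supp_in S (c%:MP : {mpoly R[n]}).
Proof. by move=> S0 b; rewrite msuppC; case: eqP => // _; rewrite inE => /eqP ->. Qed.

End SuppIn.

Definition on_vars n (J : {set 'I_n}) (a : 'X_{1..n}) :=
  [forall i, (i \notin J) ==> (a i == 0)%N].

Section OnVars.
Variable n : nat.
Implicit Types (J : {set 'I_n}) (a b : 'X_{1..n}).

Lemma on_varsP J a : reflect (forall i, i \notin J -> a i = 0%N) (on_vars J a).
Proof.
by apply: (iffP forallP) => H i; [move=> iJ; apply/eqP; have := H i; rewrite iJ
 | apply/implyP=> iJ; rewrite H].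
Qed.

Lemma on_vars0 J : on_vars J 0%MM.
Proof. by apply/on_varsP=> i _; rewrite mnm0E. Qed.

Lemma on_varsD J a b : on_vars J a -> on_vars J b -> on_vars J (a + b)%MM.
Proof.
by move=> /on_varsP Ja /on_varsP Jb; apply/on_varsP=> i iJ; rewrite mnmDE Ja // Jb.
Qed.

Lemma on_vars1 J j : j \in J -> on_vars J U_(j)%MM.
Proof.
move=> jJ; apply/on_varsP=> i iJ; rewrite mnm1E.
by case: eqP iJ => // <-; rewrite jJ.
Qed.

Definition vars_part J a : 'X_{1..n} := [multinom if i \in J then a i else 0%N | i < n].

Lemma on_vars_part J a : on_vars J (vars_part J a).
Proof. by apply/on_varsP=> i /negPf iJ; rewrite mnmE iJ. Qed.

Lemma vars_partD J a : a = (vars_part (~: J) a + vars_part J a)%MM.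
Proof.
by apply/mnmP=> i; rewrite mnmDE !mnmE inE; case: (i \in J); rewrite ?addn0.
Qed.

Lemma on_vars_split J a b c d : on_vars (~: J) a -> on_vars (~: J) c ->
  on_vars J b -> on_vars J d -> (a + b = c + d)%MM -> a = c.
Proof.
move=> /on_varsP Ja /on_varsP Jc /on_varsP Jb /on_varsP Jd /mnmP E.
apply/mnmP=> i; have := E i; rewrite !mnmDE; case: (boolP (i \in J)) => iJ.
  by rewrite Ja ?Jc // inE iJ.
by rewrite Jb ?Jd // !addn0.
Qed.

End OnVars.

(** * Monomial orders and leading exponents *)

Definition monomial_order n (le : rel 'X_{1..n}) : Prop :=
  [/\ transitive le, antisymmetric le, total le, (forall a, le 0%MM a) &
      forall a b c, le a b -> le (a + c)%MM (b + c)%MM].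

Definition has_lead (R : nzRingType) n (le : rel 'X_{1..n}) (p : {mpoly R[n]}) a :=
  a \in msupp p /\ forall b, b \in msupp p -> le b a.

Section MonomialOrder.
Variables (n : nat) (le : rel 'X_{1..n}).
Hypothesis leo : monomial_order le.
Implicit Types a b c d : 'X_{1..n}.

Lemma mo_refl a : le a a.
Proof. by case: leo => _ _ T _ _; case/orP: (T a a). Qed.

Lemma mo_trans b a c : le a b -> le b c -> le a c.
Proof. by case: leo => T _ _ _ _; apply: T. Qed.

Lemma mo_anti a b : le a b -> le b a -> a = b.
Proof. by case: leo => _ T _ _ _ ab ba; apply: T; rewrite ab. Qed.

Lemma mo_add a b c : le a b -> le (a + c)%MM (b + c)%MM.
Proof. by case: leo => _ _ _ _; apply. Qed.

Lemma mo_add2 a b c d : le a b -> le c d -> le (a + c)%MM (b + d)%MM.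
Proof.
move=> ab cd; apply: (mo_trans (mo_add c ab)).
by rewrite ![(b + _)%MM]addmC; apply: mo_add.
Qed.

Lemma mo_cancel a b c : le (a + c)%MM (b + c)%MM -> le a b.
Proof.
move=> h; have [_ _ T _ _] := leo; case/orP: (T a b) => // ba.
by have /addIm -> := mo_anti h (mo_add c ba); apply: mo_refl.
Qed.

Lemma exists_lead (R : nzRingType) (p : {mpoly R[n]}) :
  p != 0 -> exists a, has_lead le p a.
Proof.
move=> p0; have [letr _ leT _ _] := leo.
have [|a ap am] := @exists_max_seq _ le (msupp p) leT letr; first by rewrite msupp_eq0.
by exists a.
Qed.

(** No other pair of exponents has sum [a + b], so the coefficient there is the product of the
    leading ones, nonzero over a domain. *)
Lemma has_leadM (R : idomainType) (p q : {mpoly R[n]}) a b :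
  has_lead le p a -> has_lead le q b -> has_lead le (p * q) (a + b)%MM.
Proof.
case=> pa ap [qb bq]; split; last first.
  move=> c /msuppM_le /allpairsP[[d e] /= [/ap da /bq eb ->]]; exact: mo_add2.
rewrite mcoeff_msupp mpolyME raddf_sum /= big_allpairs.
rewrite (bigD1_seq a) ?msupp_uniq //= (bigD1_seq b) ?msupp_uniq //=.
rewrite mcoeffZ mcoeffX eqxx mulr1 big_seq_cond big1 => [|e /andP[eq eb]]; last first.
  rewrite mcoeffZ mcoeffX eqm_add2l (negPf eb) mulr0 //.
rewrite addr0 big_seq_cond big1 ?addr0 => [|d /andP[dp da]]; last first.
  rewrite big_seq_cond big1 // => e /andP[eq _]; rewrite mcoeffZ mcoeffX.
  case: eqP => [E|]; last by rewrite mulr0.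
  suff ad : le a d by rewrite (mo_anti ad (ap _ dp)) eqxx in da.
  apply: (@mo_cancel _ _ b); rewrite -E ![(d + _)%MM]addmC; apply: mo_add; exact: bq.
by rewrite mulf_neq0 // -mcoeff_msupp.
Qed.

End MonomialOrder.

(** * Substitutions into, and fixing, the polynomials in [X_J] *)

Section SubstOnVars.
Variables (R : comNzRingType) (n : nat) (J : {set 'I_n}).
Implicit Types (p q : {mpoly R[n]}) (t : n.-tuple {mpoly R[n]}).

Lemma supp_in_on_varsM p q : supp_in (on_vars J) p -> supp_in (on_vars J) q ->
  supp_in (on_vars J) (p * q).
Proof. by apply: supp_inM => a b; apply: on_varsD. Qed.

Lemma comp_mpoly_on_vars t p :
  (forall i, supp_in (on_vars J) (tnth t i)) -> supp_in (on_vars J) (p \mPo t).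
Proof.
move=> tJ; rewrite comp_mpolyE; apply: supp_in_sum => a _; apply: supp_inZ.
have s1 : supp_in (on_vars J) (1 : {mpoly R[n]}) by apply/supp_inC/on_vars0.
apply: big_ind => [||i _]; [exact: s1|exact: supp_in_on_varsM|].
elim: (a i) => [|e IH]; first by rewrite expr0.
by rewrite exprS; apply: supp_in_on_varsM.
Qed.

Lemma comp_mpoly_fix t p : (forall j, j \in J -> tnth t j = 'X_j) ->
  supp_in (on_vars J) p -> p \mPo t = p.
Proof.
move=> tJ pJ; rewrite comp_mpolyEX [RHS]mpolyE.
rewrite big_seq [RHS]big_seq; apply: eq_bigr => a /pJ /on_varsP aJ.
rewrite comp_mpolyX mpolyXE_id; congr (_ *: _); apply: eq_bigr => i _.
by case: (boolP (i \in J)) => [/tJ -> //|/aJ ->]; rewrite !expr0.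
Qed.

End SubstOnVars.

(** * Counting the full exponents of [m] parametrised planes *)

Section Core.
Variables (k : fieldType) (n m : nat) (le : rel 'X_{1..n}) (J : {set 'I_n}).
(** The tuple [pt s] gives the coordinates on plane [s] as polynomials in [X_J]; composing with it
    is the substitution phi_P. *)
Variable pt : 'I_m -> n.-tuple {mpoly k[n]}.
Hypothesis kinf : forall s : seq k, exists x : k, x \notin s.
Hypothesis leo : monomial_order le.
Hypothesis ptJ : forall s j, j \in J -> tnth (pt s) j = 'X_j.
Hypothesis ptN : forall s i, i \notin J ->
  supp_in (fun b => on_vars J b && le b U_(i)%MM) (tnth (pt s) i).
Hypothesis pt_sep : forall s s', s != s' -> exists i, tnth (pt s) i != tnth (pt s') i.
Implicit Types (p q : {mpoly k[n]}) (a b c g : 'X_{1..n}).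

Definition vanishing p := forall s, p \mPo pt s = 0.

(** Only the [m] planes of type [J] enter here; the other components of [A] are treated in the final
    theorem. *)
Definition full_dir g := on_vars (~: J) g /\
  forall c p, on_vars J c -> vanishing p -> ~ has_lead le p (g + c)%MM.

Lemma pt_on_vars s i : supp_in (on_vars J) (tnth (pt s) i).
Proof.
case: (boolP (i \in J)) => iJ; first by rewrite ptJ //; apply/supp_inX/on_vars1.
by move=> b /(ptN iJ) /andP[].
Qed.

Lemma size_full_dir (sg : seq 'X_{1..n}) :
  uniq sg -> (forall g, g \in sg -> full_dir g) -> (size sg <= m)%N.
Proof.
move=> us sgP; rewrite leqNgt; apply/negP=> lt_m.
pose g := tnth (in_tuple sg).
have gP i : full_dir (g i) by apply: sgP; apply: mem_tnth.
have [u [[i0 ui0] uE]] := underdetermined_system (fun i s => 'X_[g i] \mPo pt s) lt_m.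
have [y uy] := mpoly_nonvanishing kinf ui0.
(* Specializing the variables outside [J] at a point where [u i0] does not vanish makes the coefficients polynomials in the variables of [J]. *)
pose t := [tuple if i \in J then 'X_i else (y i)%:MP_[n] | i < n] : n.-tuple {mpoly k[n]}.
have tE i : tnth t i = if i \in J then 'X_i else (y i)%:MP_[n] by rewrite tnth_mktuple.
have tJ p : supp_in (on_vars J) (p \mPo t).
  apply: comp_mpoly_on_vars => i; rewrite tE; case: ifP => iJ.
    exact/supp_inX/on_vars1.
  exact/supp_inC/on_vars0.
pose f : {mpoly k[n]} := \sum_i (u i \mPo t) * 'X_[g i].
(* [t] fixes each ['X_[g i] \mPo pt s] and [pt s] fixes each [u i \mPo t], all being polynomials in
   [X_J]; so the claim is the dependency specialised by [t]. *)
have fv : vanishing f.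
  move=> s; transitivity ((\sum_i u i * ('X_[g i] \mPo pt s)) \mPo t); last first.
    by rewrite uE raddf0.
  rewrite !raddf_sum /=; apply: eq_bigr => i _.
  rewrite !rmorphM /= (comp_mpoly_fix (@ptJ s)) //; congr (_ * _).
  rewrite [RHS](@comp_mpoly_fix _ _ J) //.
  - by move=> j jJ; rewrite tE jJ.
  - by apply: comp_mpoly_on_vars => j; apply: pt_on_vars.
(* At [y] the polynomial [u i0 \mPo t] has the nonzero value of [u i0]. Distinct summands of [f]
   have disjoint supports, since an exponent determines its part outside [J]. *)
have f0 : f != 0.
  have [e ei0] : exists e, e \in msupp (u i0 \mPo t).
    have : (u i0 \mPo t) != 0.
      apply: contraNneq uy => E.
      have : (u i0 \mPo t).@[y] = 0 by rewrite E meval0.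
      rewrite comp_mpoly_meval => <-; apply/eqP/meval_eq => i.
      by rewrite tE; case: ifP; rewrite ?mevalXU ?mevalC.
    case E: (msupp (u i0 \mPo t)) => [|e r]; last by exists e; rewrite mem_head.
    by rewrite (msuppnil0 E) eqxx.
  apply/eqP=> /(congr1 (mcoeff (g i0 + e)%MM)); rewrite mcoeff0 raddf_sum /=.
  rewrite (bigD1 i0) //= mcoeffMX big1 ?addr0 => [/eqP|i ii0].
    by rewrite mcoeff_eq0 ei0.
  apply/eqP; rewrite mcoeff_eq0; apply: contra ii0.
  rewrite (perm_mem (msuppMX _ _)) => /mapP[e' e'i E].
  have gJ j : on_vars (~: J) (g j) by case: (gP j).
  have := on_vars_split (gJ i0) (gJ i) (tJ _ _ ei0) (tJ _ _ e'i) E.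
  rewrite /g !(tnth_nth 0%MM) => /eqP; rewrite nth_uniq ?ltn_ord // => /eqP E'.
  by apply/eqP/val_inj.
have [a [af am]] := exists_lead leo f0.
have := msupp_sum_le af; case/flatten_mapP=> i _.
rewrite (perm_mem (msuppMX _ _)) => /mapP[c /tJ cJ E].
have [_ /(_ c f cJ fv)] := gP i; apply; by rewrite -E.
Qed.

(** Degree in the variables outside [J]: the induction measure for rewriting modulo the vanishing
    ideal. *)
Let wdeg a := (\sum_(i | i \notin J) a i)%N.

Lemma wdegD a b : wdeg (a + b)%MM = (wdeg a + wdeg b)%N.
Proof. by rewrite /wdeg -big_split; apply: eq_bigr => i _; rewrite mnmDE. Qed.

Lemma wdeg_on_vars a : on_vars J a -> wdeg a = 0%N.
Proof. by move/on_varsP=> aJ; rewrite /wdeg big1. Qed.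

Lemma wdegU i : i \notin J -> wdeg U_(i)%MM = 1%N.
Proof.
move=> iJ; rewrite /wdeg (bigD1 i) //= mnm1E eqxx big1 // => j /andP[_ ji].
by rewrite mnm1E eq_sym (negPf ji).
Qed.

(* Modulo the vanishing ideal, [X_i ^ m] rewrites to smaller monomials of lower degree in the variables outside [J]. *)
Lemma prod_sub_tail i (S : seq 'I_m) : i \notin J ->
  supp_in (fun b => le b (U_(i) *+ size S)%MM && (wdeg b < size S)%N)
    ('X_i ^+ size S - \prod_(s <- S) ('X_i - tnth (pt s) i)).
Proof.
move=> iJ; elim: S => [|s S IH] /=; first by rewrite big_nil expr0 subrr; apply: supp_in0.
rewrite big_cons; set P := \prod_(s <- S) _ in IH *.
set r := _ - P in IH; set L := tnth _ _.
(* Each summand contains [r] or replaces a factor ['X_i] by [L], which has degree 0 outside [J] and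
   exponents at most [U_(i)]; so both bounds persist. *)
have -> : 'X_i ^+ (size S).+1 - ('X_i - L) * P =
    'X_i * r + L * 'X_i ^+ size S - L * r.
  rewrite /r exprS !mulrBr mulrBl; move: ('X_i * _) (L * P) (L * _) ('X_i * P) => A B C D.
  by rewrite !opprB [B - C]addrC [RHS]addrA addrK [RHS]addrAC addrA.
have Lb := @ptN s i iJ; rewrite mulmS.
apply: supp_inD; first apply: supp_inD.
- apply: (supp_inM _ (@supp_inX _ _ (pred1 U_(i)%MM) _ (eqxx _)) IH) => a b /= /eqP ->.
  case/andP=> bl bw; rewrite wdegD wdegU // add1n ltnS bw andbT.
  by apply: mo_add2 => //; apply: mo_refl.
- rewrite mpolyXn; apply: (supp_inM _ Lb (@supp_inX _ _ (pred1 (U_(i) *+ size S)%MM) _ (eqxx _))).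
  move=> a b /= /andP[aJ al] /eqP ->; rewrite wdegD wdeg_on_vars //.
  rewrite mo_add //=; elim: (size S) => [|j IHj]; first by rewrite mulm0n (wdeg_on_vars (on_vars0 _)).
  by rewrite mulmS wdegD wdegU // add0n add1n ltnS in IHj *.
- apply: supp_inN; apply: (supp_inM _ Lb IH) => a b /= /andP[aJ al] /andP[bl bw].
  by rewrite wdegD wdeg_on_vars // add0n ltnS (ltnW bw) andbT mo_add2.
Qed.

Lemma exists_full_dir_notin (sg : seq 'X_{1..n}) :
  (size sg < m)%N -> exists2 g, full_dir g & g \notin sg.
Proof.
move=> lt_m; apply: NNPP => nex.
have sgP g : full_dir g -> g \in sg.
  by move=> gf; apply/negPn/negP => gs; apply: nex; exists g.
have [u [[s0 us0] uE]] :=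
  underdetermined_system (fun s (i : 'I_(size sg)) => 'X_[nth 0%MM sg i] \mPo pt s) lt_m.
pose phi p := \sum_s u s * (p \mPo pt s).
have phiD p q : phi (p + q) = phi p + phi q.
  by rewrite -big_split; apply: eq_bigr => s _; rewrite raddfD mulrDr.
have phiZ (x : k) p : phi (x *: p) = x *: phi p.
  by rewrite scaler_sumr; apply: eq_bigr => s _; rewrite comp_mpolyZ scalerAr.
have phi_0 : phi 0 = 0 by rewrite /phi big1 // => s _; rewrite comp_mpoly0 mulr0.
have phi_van p : vanishing p -> phi p = 0.
  by move=> pv; rewrite /phi big1 // => s _; rewrite pv mulr0.
have phiE p : phi p = \sum_(a <- msupp p) p@_a *: phi 'X_[a].
  rewrite {1}[p]mpolyE; elim: (msupp p) => [|a r IH]; first by rewrite !big_nil.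
  by rewrite !big_cons phiD phiZ IH.
(* Each [pt s] fixes the monomials in [X_J]. *)
have phiM c p : on_vars J c -> phi (p * 'X_[c]) = phi p * 'X_[c].
  move=> cJ; rewrite mulr_suml; apply: eq_bigr => s _.
  rewrite rmorphM /= (@comp_mpoly_fix _ _ J _ 'X_[c]) ?mulrA //; first exact: ptJ.
  exact: supp_inX.
have phi_full g : full_dir g -> phi 'X_[g] = 0.
  move=> /sgP gs; have gi : (index g sg < size sg)%N by rewrite index_mem.
  by have := uE (Ordinal gi); rewrite /= nth_index.
(* Exponents outside [J] with all entries below [m]: the finitely many ones to which no rewriting of
   ['X_i ^+ m] applies. *)
pose box := [seq vars_part (~: J) [multinom (f i : nat) | i < n] | f : {ffun 'I_n -> 'I_m}].
have box_on g : g \in box -> on_vars (~: J) g.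
  by case/imageP=> f _ ->; apply: on_vars_part.
have boxP g : on_vars (~: J) g -> (forall i, g i < m)%N -> g \in box.
  move=> gJ gm; apply/imageP; exists [ffun i => Ordinal (gm i)] => //.
  apply/mnmP=> i; rewrite !mnmE ffunE /=; case: ifP => // iJ.
  by move/on_varsP: gJ => -> //; rewrite iJ.
(* [F a r] says that the exponents of [r] are bounded by [a + (t - g)] for some pair [(g, t)], with the subtraction moved across. *)
pose pairs := [seq (g, t) | g <- box, t <- msupp (phi 'X_[g])].
pose F a (r : {mpoly k[n]}) := forall e, e \in msupp r ->
  exists2 z, z \in pairs & le (e + z.1)%MM (a + z.2)%MM.
(* Induction on the degree outside [J]: the part on [J] is split off, a remainder in [box] supplies
   its own pairs, and otherwise some ['X_i ^+ m] is rewritten into smaller exponents. *)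
have F_all N a : (wdeg a < N)%N -> F a (phi 'X_[a]).
  elim: N a => // N IH a aN.
  suff Fg : F (vars_part (~: J) a) (phi 'X_[vars_part (~: J) a]).
    rewrite (vars_partD J a) mpolyXD phiM ?on_vars_part // => e.
    rewrite (perm_mem (msuppMX _ _)) => /mapP[e' /Fg [z zp zl] ->]; exists z => //.
    have := mo_add leo (vars_part J a) zl.
    by congr (le _ _); apply/mnmP=> i; rewrite !mnmDE; lia.
  have gN : wdeg (vars_part (~: J) a) = wdeg a.
    by rewrite [in RHS](vars_partD J a) wdegD (wdeg_on_vars (on_vars_part _ _)) addn0.
  have gJ : on_vars (~: J) (vars_part (~: J) a) by apply: on_vars_part.
  set g := vars_part _ a in gN gJ *.
  case: (boolP [forall i, g i < m]%N) => [/forallP gm|].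
    move=> e ge; exists (g, e); last by rewrite addmC mo_refl.
    by apply/allpairsPdep; exists g, e; split=> //; apply: boxP.
  case/forallPn=> i; rewrite -leqNgt => gm.
  have iJ : i \notin J.
    apply: contraL gm => iJ; move/on_varsP: gJ => -> //; last by rewrite inE iJ.
    by rewrite -ltnNge; apply: leq_ltn_trans lt_m.
  have gE : g = (g - U_(i) *+ m + U_(i) *+ m)%MM.
    rewrite submK //; apply/mnm_lepP => j; rewrite mulmnE mnm1E.
    by case: eqP => [<-|_]; rewrite ?mul1n.
  have := @prod_sub_tail i (enum 'I_m) iJ; rewrite size_enum_ord.
  set Q := \prod_(s <- _) _ => rs.
  (* On plane [s] the factor of [Q] with index [s] is zero. *)
  have Qv p : vanishing (p * Q).
    move=> s; rewrite rmorphM /= /Q rmorph_prod /= big_enum (bigD1 s) //=.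
    rewrite raddfB /= comp_mpolyXU -tnth_nth (@comp_mpoly_fix _ _ J _ (tnth (pt s) i)).
    + by rewrite subrr mul0r mulr0.
    + exact: ptJ.
    + exact: pt_on_vars.
  have -> : phi 'X_[g] = phi ('X_[g - U_(i) *+ m] * ('X_i ^+ m - Q)).
    rewrite mulrBr mpolyXn -mpolyXD -gE phiD -scaleN1r phiZ (phi_van _ (Qv _)).
    by rewrite scaler0 addr0.
  rewrite phiE => e /msupp_sum_le /flatten_mapP[b]; rewrite filter_predT.
  case/msuppM_le/allpairsP=> -[b1 b2] /= []; rewrite msuppX inE => /eqP -> /rs.
  case/andP=> b2l b2w -> /msuppZ_le /IH [|z zp zl].
    move: aN; rewrite -gN {1}gE !wdegD ltnS; apply: leq_trans.
    rewrite ltn_add2l (leq_trans b2w) //; elim: (m) => [|j IHj] //.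
    by rewrite mulmS wdegD wdegU // add1n ltnS.
  exists z => //; apply: mo_trans zl _ => //; apply: mo_add => //.
  by rewrite [X in le _ X]gE mo_add2 // mo_refl.
(* A product vanishing on every plane except [s0] isolates the term of [u s0]; its factors come from
   coordinates in which the parametrisations differ. *)
have [f phif] : exists f, phi f != 0.
  have hE s : exists p, (s != s0 -> p \mPo pt s = 0) /\ p \mPo pt s0 != 0.
    case: (eqVneq s s0) => [->|ss0].
      by exists 1; rewrite comp_mpoly1 oner_neq0.
    have [i ni] := pt_sep ss0; exists ('X_i - tnth (pt s) i).
    rewrite !raddfB /= !comp_mpolyXU -!tnth_nth.
    rewrite !(@comp_mpoly_fix _ _ J _ (tnth (pt s) i)); try exact: ptJ; try exact: pt_on_vars.
    by rewrite subrr subr_eq0 eq_sym ni.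
  have [h hP] := fin_all_exists hE.
  pose f := \prod_s h s; exists f; rewrite /phi (bigD1 s0) //= big1 => [|s ss0].
    rewrite addr0 rmorph_prod mulf_neq0 //; apply/prodf_neq0 => s _; exact: (hP s).2.
  by rewrite rmorph_prod /= (bigD1 s) //= (hP s).1 // mul0r mulr0.
have pairs0 : pairs != [::].
  have [e] : exists e, e \in msupp (phi f).
    case E: (msupp (phi f)) => [|e r]; last by exists e; rewrite mem_head.
    by rewrite (msuppnil0 E) eqxx in phif.
  rewrite phiE => /msupp_sum_le /flatten_mapP[b _ /msuppZ_le /(F_all _ _ (ltnSn _))[z]].
  by move=> zp _; apply: contraTneq zp => ->.
have [_ _ leT _ _] := leo.
(* This compares [t - g], again with the subtractions moved across. *)
pose rr (z z' : 'X_{1..n} * 'X_{1..n}) := le (z.2 + z'.1)%MM (z'.2 + z.1)%MM.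
have rr_total : total rr by move=> z z'; apply: leT.
have rr_trans : transitive rr.
  move=> y x z xy yz; apply: (@mo_cancel _ _ leo _ _ (y.1 + y.2)%MM).
  have := mo_add2 leo xy yz.
  by congr (le _ _); apply/mnmP=> i; rewrite !mnmDE; lia.
have [[g0 t0] p0 pmax] := exists_max_seq rr_total rr_trans pairs0.
have [g0b t0s] : g0 \in box /\ t0 \in msupp (phi 'X_[g0]).
  by case/allpairsPdep: p0 => g [t [gb ts [-> ->]]].
(* [phi] does not kill ['X_[g0]], so [g0] is not full. *)
have [c [p [cJ pv [pa am]]]] : exists c p, [/\ on_vars J c, vanishing p & has_lead le p (g0 + c)%MM].
  apply: NNPP => H; have : full_dir g0.
    split; first exact: box_on.
    by move=> c p cJ pv pl; apply: H; exists c, p.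
  by move/phi_full=> E; rewrite E msupp0 in t0s.
have := congr1 (mcoeff (t0 + c)%MM) (phi_van p pv).
rewrite phiE (bigD1_seq (g0 + c)%MM) ?msupp_uniq //= mpolyXD phiM // mcoeffD mcoeffZ.
rewrite [(t0 + c)%MM]addmC mcoeffMX mcoeff0 => /eqP.
rewrite (raddf_sum (mcoeff (c + t0)%MM)) /= big_seq_cond big1 => [|b /andP[bp bg]].
  by rewrite addr0 mulf_eq0 !mcoeff_eq0 pa t0s.
(* If another exponent [b] of [p] contributed at [t0 + c], then [F_all] and the maximality of
   [t0 - g0] would put [b] above the leading exponent [g0 + c]. *)
apply/eqP; rewrite mcoeff_eq0; apply: contra bg => /msuppZ_le /(F_all _ _ (ltnSn _))[z zp zl].
apply/eqP; apply: (mo_anti leo (am _ bp)).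
apply: (@mo_cancel _ _ leo _ _ (t0 + z.1)%MM).
apply: (mo_trans leo (b := (b + z.2 + g0)%MM)).
  by have := mo_add leo g0 zl; congr (le _ _); apply/mnmP=> i; rewrite !mnmDE; lia.
have := mo_add leo b (pmax _ zp) => /=.
by congr (le _ _); apply/mnmP=> i; rewrite !mnmDE; lia.
Qed.

End Core.

(** * Affine planes as graphs over their free coordinates *)

Section Planes.
Variables (k : fieldType) (n d : nat).
Implicit Types (P : aplane k d n) (J : {set 'I_n}) (y : 'I_n -> k).

Definition graph_pt J (x0 : 'rV[k]_n) (w : 'I_n -> 'rV[k]_n) y : 'rV[k]_n :=
  x0 + \sum_(j in J) y j *: w j.

(** Here [x0] is the point over the origin of [k^J], and [w j] the direction in which [X_j] grows by
    1 with the other free coordinates fixed; for [i] outside [J], [w j 0 i] is the coefficient of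
    [X_j] in the affine function [X_i]. *)
Definition plane_graph P J x0 w := [/\
  forall x, in_aplane P x -> x = graph_pt J x0 w (x 0),
  forall y, in_aplane P (graph_pt J x0 w y) &
  forall y j, j \in J -> graph_pt J x0 w y 0 j = y j].

Lemma graph_ptE J x0 w y i :
  graph_pt J x0 w y 0 i = x0 0 i + \sum_(j in J) y j * w j 0 i.
Proof. by rewrite mxE summxE; congr (_ + _); apply: eq_bigr => j _; rewrite mxE. Qed.

Lemma eq_graph_pt J x0 w y y' : (forall j, j \in J -> y j = y' j) ->
  graph_pt J x0 w y = graph_pt J x0 w y'.
Proof. by move=> e; congr (_ + _); apply: eq_bigr => j /e ->. Qed.

Lemma graph_pt_upd J x0 w y j c : j \in J ->
  graph_pt J x0 w (fun l => if l == j then c else y l) =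
  graph_pt J x0 w (fun l => if l == j then 0 else y l) + c *: w j.
Proof.
move=> jJ; rewrite /graph_pt -addrA; congr (_ + _).
rewrite (bigD1 j) //= [in RHS](bigD1 j) //= eqxx scale0r add0r addrC.
by congr (_ + _); apply: eq_bigr => l /andP[_ /negPf ->].
Qed.

(** Affine combinations of the points over 0 and over the unit vectors stay in the plane and reach
    all values of the free coordinates; uniqueness leaves no other point. *)
Lemma free_vars_graph P J : free_vars P J -> exists x0 w, plane_graph P J x0 w.
Proof.
move=> fr; have [x0 [[x0P x0J] _]] := fr 0.
have [X XP] := fin_all_exists (fun j => fr (delta_mx 0 j)).
exists x0, (fun j => X j - x0).
have inP y : in_aplane P (graph_pt J x0 (fun j => X j - x0) y).
  rewrite /in_aplane /graph_pt addrAC; apply: addmx_sub => //.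
  apply: summx_sub => j _; apply: scalemx_sub.
  have [[XjP _] _] := XP j.
  rewrite -(subrK P.1 (X j)) -addrA; apply: addmx_sub => //.
  by rewrite -opprB eqmx_opp.
have coord y j : j \in J -> graph_pt J x0 (fun j => X j - x0) y 0 j = y j.
  move=> jJ; rewrite graph_ptE x0J // mxE add0r (bigD1 j) //= big1 => [|l /andP[lJ lj]].
    have [[_ Xj] _] := XP j; rewrite addr0 !mxE x0J // Xj // !mxE !eqxx.
    by rewrite subr0 mulr1.
  have [[_ Xl] _] := XP l; rewrite !mxE x0J // Xl // !mxE eq_sym (negPf lj) andbF.
  by rewrite subr0 mulr0.
split=> // x xP; have [z [_ zu]] := fr x.
transitivity z; [by apply/esym/zu|apply: zu; split=> // j jJ; exact: coord].
Qed.

Lemma plane_graph_delta P J x0 w : plane_graph P J x0 w ->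
  forall j l, j \in J -> l \in J -> w j 0 l = (l == j)%:R.
Proof.
case=> _ _ coord j l jJ lJ.
have := coord (fun l => if l == j then 1 else 0) l lJ.
rewrite (graph_pt_upd _ _ (fun=> 0)) // scale1r mxE (coord _ _ lJ) if_same add0r => ->.
by case: eqP.
Qed.

(** The exchange amounts to solving the equation for [X_i] for [X_j], whose coefficient is
    [w j 0 i]; if this is 0, moving along [w j] violates uniqueness. *)
Lemma plane_graph_swap P J x0 w i j : plane_graph P J x0 w ->
  j \in J -> i \notin J -> free_vars P (i |: (J :\ j)) <-> w j 0 i != 0.
Proof.
move=> G jJ iJ; have [Px inP coord] := G; split=> [fr|wji y].
  apply/eqP => wji; have [x [_ xu]] := fr 0.
  pose y0 c l := if l == j then c else 0 : k.
  have [z [[zP zJ] zu]] := fr (graph_pt J x0 w (y0 0)).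
  have E c : z = graph_pt J x0 w (y0 c).
    apply: zu; split=> // l; rewrite !inE /y0 (graph_pt_upd _ _ (fun=> 0)) //.
    case/predU1P=> [->|/andP[lj lJ]]; first by rewrite !mxE wji mulr0 addr0.
    by rewrite !mxE (plane_graph_delta G) // (negPf lj) mulr0 addr0.
  have := congr1 (fun x : 'rV_n => x 0 j) (etrans (esym (E 0)) (E 1)).
  by rewrite !coord // /y0 eqxx => /esym/eqP; rewrite oner_eq0.
pose s c := graph_pt J x0 w (fun l => if l == j then c else y 0 l).
have sE c : s c 0 i = s 0 0 i + c * w j 0 i.
  by rewrite /s graph_pt_upd // mxE [X in _ + X]mxE.
pose c := (y 0 i - s 0 0 i) / w j 0 i.
exists (s c); split=> [|x [xP xJ]].
  split=> [|l]; [exact: inP|rewrite !inE => /predU1P[->|/andP[lj lJ]]].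
    by rewrite sE divfK // addrC subrK.
  by rewrite coord // (negPf lj).
have xs : x = s (x 0 j).
  rewrite {1}(Px x xP); apply: eq_graph_pt => l lJ.
  by case: eqP => [->//|/eqP lj]; apply: xJ; rewrite !inE lj lJ orbT.
rewrite xs; congr (s _); rewrite /c -(xJ i) ?setU11 // {1}xs sE.
by rewrite addrC addKr mulfK.
Qed.

(** If the square matrix of the [J]-columns is invertible, the projection is bijective; if it is
    singular, a relation between these columns is a linear form in [X_J] constant on the plane. *)
Lemma coord_dependence P J : #|J| = d -> ~ free_vars P J ->
  exists l : 'I_n -> k, exists c, [/\ exists2 j, j \in J & l j != 0,
    forall j, j \notin J -> l j = 0 &
    forall x, in_aplane P x -> \sum_j l j * x 0 j = c].
Proof.
move=> cJ nfr; pose h (t : 'I_d) : 'I_n := enum_val (cast_ord (esym cJ) t).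
have hJ t : h t \in J by apply: enum_valP.
have hI : injective h by move=> s t /enum_val_inj/cast_ord_inj.
have hS j : j \in J -> exists t, h t = j.
  move=> jJ; exists (cast_ord cJ (enum_rank_in jJ j)).
  by rewrite /h cast_ordK enum_rankK_in.
pose MJ : 'M_d := colsub h P.2.
case: (boolP (MJ \in unitmx)) => MJu.
  case: nfr => y; pose v := colsub h (y - P.1) *m invmx MJ.
  exists (P.1 + v *m P.2); split=> [|x [xP xJ]].
    split=> [|j /hS[t <-]]; first by rewrite /in_aplane addrC addKr submxMl.
    have : colsub h (v *m P.2) = colsub h (y - P.1).
      by rewrite -mulmx_colsub mulmxKV.
    move/(congr1 (fun z : 'rV_d => z 0 t)); rewrite !mxE => ->.
    by rewrite addrC subrK.
  have /submxP[v' v'E] := xP; suff -> : v = v' by rewrite -v'E addrC subrK.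
  rewrite /v -[RHS](mulmxK MJu) mulmx_colsub -v'E; congr (_ *m _).
  by apply/rowP=> t; rewrite !mxE xJ.
have : \det MJ^T == 0 by move: MJu; rewrite unitmxE unitfE negbK det_tr.
case/det0P=> u u0 uM.
exists (fun j => \sum_t (if h t == j then u 0 t else 0)), (\sum_t u 0 t * P.1 0 (h t)).
have lh t : \sum_t' (if h t' == h t then u 0 t' else 0) = u 0 t.
  rewrite (bigD1 t) //= eqxx big1 ?addr0 // => t' t't.
  by rewrite (inj_eq hI) (negPf t't).
split.
- have /rV0Pn[t ut] := u0; exists (h t) => //; by rewrite lh.
- move=> j jJ; rewrite big1 // => t _; case: eqP => // e; by rewrite -e hJ in jJ.
move=> x xP.
have -> : \sum_j (\sum_t (if h t == j then u 0 t else 0)) * x 0 j =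
    \sum_t u 0 t * x 0 (h t).
  under eq_bigr do rewrite mulr_suml.
  rewrite exchange_big; apply: eq_bigr => t _; rewrite (bigD1 (h t)) //= eqxx.
  by rewrite big1 ?addr0 // => j; rewrite eq_sym => /negPf ->; rewrite mul0r.
apply/eqP; rewrite -subr_eq0 -sumrB; apply/eqP.
have /submxP[v vE] := xP.
transitivity ((u *m MJ^T *m v^T) 0 0); last by rewrite uM mul0mx mxE.
rewrite -mulmxA -trmx_mul mulmx_colsub -vE !mxE; apply: eq_bigr => t _.
by rewrite !mxE mulrBr.
Qed.

End Planes.

(** * Polynomials vanishing on one plane, according to its type *)

Definition vanishes_on (k : fieldType) n (A : 'rV[k]_n -> Prop) (p : {mpoly k[n]}) :=
  forall x, A x -> p.@[x 0] = 0.

Section PlaneIdeal.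
Variables (k : fieldType) (n d : nat) (le : rel 'X_{1..n}).
Hypothesis kinf : forall s : seq k, exists x : k, x \notin s.
Hypothesis leo : monomial_order le.
Hypothesis leU : forall i j : 'I_n, (i < j)%N -> le U_(i)%MM U_(j)%MM.
Implicit Types (P : aplane k d n) (J : {set 'I_n}).

(** By the exchange criterion, minimality excludes [X_j] with [i < j] from the equation for [X_i].
    Over an infinite field, vanishing on the plane means that the substitution gives the zero
    polynomial. *)
Lemma min_free_vars_param P J : min_free_vars P J ->
  exists t : n.-tuple {mpoly k[n]}, [/\
    forall j, j \in J -> tnth t j = 'X_j,
    forall i, i \notin J ->
      supp_in (fun b => on_vars J b && le b U_(i)%MM) (tnth t i),
    forall p, p \mPo t = 0 <-> vanishes_on (in_aplane P) p &
    forall x, in_aplane P x <-> forall i, x 0 i = (tnth t i).@[x 0]].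
Proof.
case=> fr mn; have [x0 [w G]] := free_vars_graph fr; have [Px inP coord] := G.
pose t : n.-tuple {mpoly k[n]} := [tuple if i \in J then 'X_i else
  (x0 0 i)%:MP_[n] + \sum_(j in J) w j 0 i *: 'X_j | i < n].
have tE i : tnth t i = if i \in J then 'X_i else
  (x0 0 i)%:MP_[n] + \sum_(j in J) w j 0 i *: 'X_j by rewrite tnth_mktuple.
have tP y i : (tnth t i).@[y] = graph_pt J x0 w y 0 i.
  rewrite tE; case: ifP => iJ; first by rewrite mevalXU coord.
  rewrite graph_ptE mevalD mevalC raddf_sum; congr (_ + _).
  by apply: eq_bigr => j _; rewrite /= mevalZ mevalXU mulrC.
exists t; split=> [j jJ|i iJ|p|x].
- by rewrite tE jJ.
- rewrite tE (negPf iJ); apply: supp_inD.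
    apply: supp_inC; rewrite on_vars0 /=; by case: leo.
  apply: supp_in_sum => j jJ; case: (ltnP i j) => ij.
    suff -> : w j 0 i = 0 by rewrite scale0r; apply: supp_in0.
    apply/eqP/negPn/negP => /(plane_graph_swap G jJ iJ); exact: mn.
  apply/supp_inZ/supp_inX; rewrite on_vars1 //=; apply: leU.
  by rewrite ltn_neqAle ij andbT; apply: contraNneq iJ => /val_inj <-.
- split=> [pt x /Px xE|pv].
    have := congr1 (meval (x 0)) pt; rewrite meval0 comp_mpoly_meval => <-.
    by apply: meval_eq => i; rewrite tP -xE.
  apply: contraTeq isT => /(mpoly_nonvanishing kinf)[y]; rewrite comp_mpoly_meval.
  move/eqP=> H; exfalso; apply: H; rewrite -[RHS](pv _ (inP y)).
  by apply: meval_eq => i; rewrite tP.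
- split=> [/Px xE i|xE]; first by rewrite tP -xE.
  suff -> : x = graph_pt J x0 w (x 0) by apply: inP.
  by apply/rowP=> i; rewrite -tP -xE.
Qed.

Lemma meval_sumXU (l : 'I_n -> k) (y : 'I_n -> k) :
  (\sum_i l i *: 'X_i : {mpoly k[n]}).@[y] = \sum_i l i * y i.
Proof. by rewrite raddf_sum; apply: eq_bigr => i _; rewrite /= mevalZ mevalXU. Qed.

Lemma mcoeff_affine (l : 'I_n -> k) c j :
  (\sum_i l i *: 'X_i - c%:MP : {mpoly k[n]})@_U_(j) = l j.
Proof.
rewrite mcoeffB mcoeffC mnm1_eq0 mulr0 subr0 raddf_sum (bigD1 j) //= big1 => [|i ij].
  by rewrite addr0 mcoeffZ mcoeffXU eqxx mulr1.
by rewrite mcoeffZ mcoeffXU (negPf ij) mulr0.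
Qed.

(** It suffices to find an affine equation of the plane containing some [X_j], [j] in [J], such that
    the variables outside [J] in it all have index below [j]. *)
Lemma non_min_free_vars_lead P J : #|J| = d -> ~ min_free_vars P J ->
  exists p a, [/\ vanishes_on (in_aplane P) p, has_lead le p a & on_vars J a].
Proof.
move=> cJ nm.
suff [l [c [Pl [j [jJ lj lJ]]]]] : exists l : 'I_n -> k, exists c,
    (forall x, in_aplane P x -> \sum_i l i * x 0 i = c) /\
    exists j, [/\ j \in J, l j != 0 &
      forall i, i \notin J -> l i != 0 -> (i < j)%N].
  pose p : {mpoly k[n]} := \sum_i l i *: 'X_i - c%:MP.
  have pj : U_(j)%MM \in msupp p by rewrite mcoeff_msupp mcoeff_affine.
  have [a pa] : exists a, has_lead le p a.
    by apply: exists_lead => //; apply: contraTneq pj => ->; rewrite msupp0.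
  exists p, a; split=> // [x xP|].
    by rewrite mevalB mevalC meval_sumXU Pl // subrr.
  have [ap am] := pa; have := ap; rewrite /p => /msuppB_le; rewrite mem_cat.
  case/orP=> [/msupp_sum_le/flatten_mapP[i _] /msuppZ_le|]; last first.
    rewrite msuppC; case: ifP => //; rewrite inE => _ /eqP ->; exact: on_vars0.
  rewrite msuppX inE => /eqP aE; case: (boolP (i \in J)) => iJ.
    by rewrite aE; apply: on_vars1.
  have li : l i != 0 by move: ap; rewrite aE mcoeff_msupp mcoeff_affine.
  have ij := lJ i iJ li; have := mo_anti leo (leU ij); rewrite -aE => /(_ (am _ pj)).
  move/(congr1 (fun m : 'X_{1..n} => m j)); rewrite aE !mnm1E eqxx.
  by case: eqP ij => [->|//]; rewrite ltnn.
(* Without freeness there is an equation in [X_J] alone; with it, non-minimality makes some [X_j]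
   occur in the equation for an [X_i] with [i < j]. *)
case: (classic (free_vars P J)) => [fr|/(coord_dependence cJ)]; last first.
  case=> l [c [[j jJ lj] lJ Pl]]; exists l, c; split=> //; exists j; split=> // i iJ.
  by rewrite lJ // eqxx.
have [j [i [jJ iJ ij fr']]] : exists j i : 'I_n, [/\ j \in J, i \notin J, (i < j)%N &
    free_vars P (i |: (J :\ j))].
  apply: NNPP => H; apply: nm; split=> // j i jJ iJ ij fr'; apply: H.
  by exists j, i.
have [x0 [w G]] := free_vars_graph fr.
have wji := (plane_graph_swap G jJ iJ).1 fr'; have [Px _ _] := G.
exists (fun m => if m == i then -1 else if m \in J then w m 0 i else 0), (- x0 0 i).
split=> [x xP|].
  rewrite (bigD1 i) //= eqxx mulN1r {1}(Px x xP) graph_ptE opprD -addrA.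
  rewrite [X in _ + (_ + X)](_ : _ = \sum_(m in J) x 0 m * w m 0 i) ?addNr ?addr0 //.
  rewrite [LHS]big_mkcond [RHS]big_mkcond; apply: eq_bigr => m _ /=.
  case: eqP => [->|_] /=; first by rewrite (negPf iJ).
  by case: ifP; rewrite ?mul0r // mulrC.
exists j; split=> //.
  by case: (eqVneq j i) => [e|_]; [rewrite e (negPf iJ) in jJ|rewrite jJ].
by move=> m mJ; rewrite (negPf mJ); case: (eqVneq m i) => [->|]; rewrite ?eqxx.
Qed.

End PlaneIdeal.

(** * Translation between the two encodings of exponents and polynomials *)

Section Encoding.
Variables (k : fieldType) (n : nat).
Implicit Types (a b : exps n) (m : 'X_{1..n}).

Definition mnm_of_exps a : 'X_{1..n} := [multinom a i | i < n].
Definition exps_of_mnm m : exps n := [ffun i => m i].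

Lemma mnm_of_expsK : cancel mnm_of_exps exps_of_mnm.
Proof. by move=> a; apply/ffunP=> i; rewrite ffunE mnmE. Qed.

Lemma exps_of_mnmK : cancel exps_of_mnm mnm_of_exps.
Proof. by move=> m; apply/mnmP=> i; rewrite mnmE ffunE. Qed.

Lemma exps_of_mnmD m m' : exps_of_mnm (m + m') = expadd (exps_of_mnm m) (exps_of_mnm m').
Proof. by apply/ffunP=> i; rewrite !ffunE mnmDE. Qed.

Lemma mnm_of_expsD a b : mnm_of_exps (expadd a b) = (mnm_of_exps a + mnm_of_exps b)%MM.
Proof. by rewrite -[RHS]exps_of_mnmK exps_of_mnmD !mnm_of_expsK. Qed.

Lemma term_order_mnm (le : rel (exps n)) : term_order le ->
  monomial_order (relpre exps_of_mnm le).
Proof.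
case=> [r t a T [z c]]; split=> /=.
- by move=> y x w; apply: t.
- by move=> x y /a /(can_inj exps_of_mnmK).
- by move=> x y; apply: T.
- move=> m; rewrite (_ : exps_of_mnm 0 = exp0 n) //.
  by apply/ffunP=> i; rewrite !ffunE mnm0E.
- by move=> x y w /=; rewrite !exps_of_mnmD; apply: c.
Qed.

Definition mpoly_of_terms (f : Defs.mpoly k n) : {mpoly k[n]} :=
  \sum_(t <- f) t.2 *: 'X_[mnm_of_exps t.1].

Lemma meval_mpoly_of_terms f (x : 'rV[k]_n) :
  Defs.meval f x = (mpoly_of_terms f).@[x 0].
Proof.
rewrite raddf_sum; apply: eq_bigr => t _; rewrite /= mevalZ mevalX.
by congr (_ * _); apply: eq_bigr => i _; rewrite mnmE.
Qed.

Lemma mcoeff_mpoly_of_terms f a : mcoef f a = (mpoly_of_terms f)@_(mnm_of_exps a).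
Proof.
rewrite /mcoef raddf_sum big_mkcond; apply: eq_bigr => t _; rewrite /= mcoeffZ mcoeffX.
by rewrite (inj_eq (can_inj mnm_of_expsK)); case: eqP; rewrite ?mulr1 ?mulr0.
Qed.

Lemma mpoly_of_terms_surj p : exists f, mpoly_of_terms f = p.
Proof.
exists [seq (exps_of_mnm m, p@_m) | m <- msupp p].
by rewrite /mpoly_of_terms big_map [RHS]mpolyE; under eq_bigr do rewrite /= exps_of_mnmK.
Qed.

Lemma in_CP (le : rel (exps n)) (A : 'rV[k]_n -> Prop) a : in_C le A a <->
  exists p, vanishes_on A p /\ has_lead (relpre exps_of_mnm le) p (mnm_of_exps a).
Proof.
split=> [[f [fA [fa am]]]|[p [pA [pa am]]]].
  exists (mpoly_of_terms f); split=> [x /fA|]; first by rewrite meval_mpoly_of_terms.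
  split=> [|m]; first by rewrite mcoeff_msupp -mcoeff_mpoly_of_terms.
  rewrite mcoeff_msupp /= mnm_of_expsK => mf; apply: am.
  by rewrite mcoeff_mpoly_of_terms exps_of_mnmK.
have [f fE] := mpoly_of_terms_surj p; exists f; split=> [x /pA|].
  by rewrite meval_mpoly_of_terms fE.
split=> [|b]; rewrite mcoeff_mpoly_of_terms fE -mcoeff_msupp // => /am /=.
by rewrite !mnm_of_expsK.
Qed.

Lemma on_vars_mnm (J : {set 'I_n}) a :
  on_vars J (mnm_of_exps a) <-> forall i, i \notin J -> a i = 0%N.
Proof.
split=> [/on_varsP H i /H|H]; first by rewrite mnmE.
by apply/on_varsP=> i /H; rewrite mnmE.
Qed.

End Encoding.

(** * Reduction from all components of [A] to the planes of type [J] *)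

Theorem mainTheorem2 (k : fieldType) (n d : nat) (le : rel (exps n))
    (ps : seq (aplane k d n)) :
  (forall s : seq k, exists x : k, x \notin s) ->
  (1 <= n)%N -> (d <= n)%N ->
  term_order le -> vars_increasing le ->
  (forall P, P \in ps -> is_aplane P) ->
  (forall i j, (i < size ps)%N -> (j < size ps)%N -> i != j ->
     exists x, in_aplane (nth (0, 0) ps i) x != in_aplane (nth (0, 0) ps j) x) ->
  let A := fun x : 'rV[k]_n => has (fun P => in_aplane P x) ps in
  forall J : {set 'I_n}, #|J| = d ->
    exists m : nat,
      has_card (fun i : nat => (i < size ps)%N /\ min_free_vars (nth (0, 0) ps i) J) m /\
      has_card (dplane_in (in_D le A) J) m.
Proof.
move=> kinf _ _ le_ord le_vars _ distinct A J cJ.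
have leo := term_order_mnm le_ord; set lem := relpre _ le in leo.
have leU (i j : 'I_n) : (i < j)%N -> lem U_(i)%MM U_(j)%MM.
  have E l : exps_of_mnm U_(l) = expe l.
    by apply/ffunP=> q; rewrite !ffunE mnm1E eq_sym; case: eqP.
  by move=> ij; rewrite /lem /= !E; apply: le_vars.
have [t ut tP] := seq_comprehension
  (fun i => min_free_vars (nth (0, 0) ps i) J) (iota_uniq 0 (size ps)).
have {}tP i : i \in t <-> (i < size ps)%N /\ min_free_vars (nth (0, 0) ps i) J.
  by rewrite tP mem_iota.
exists (size t); split; first by exists t.
pose plane (s : 'I_(size t)) := nth (0, 0) ps (tnth (in_tuple t) s).
have tsP s : tnth (in_tuple t) s \in t by apply: mem_tnth.
have [pt ptP] := fin_all_exists (fun s => min_free_vars_param kinf leo leU ((tP _).1 (tsP s)).2).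
(* A parametrisation determines its plane, and the planes are distinct. *)
have pt_sep s s' : s != s' -> exists i, tnth (pt s) i != tnth (pt s') i.
  move=> ss'; case: (boolP [exists i, tnth (pt s) i != tnth (pt s') i]) => [/existsP //|/existsPn E].
  have [x] : exists x, in_aplane (plane s) x != in_aplane (plane s') x.
    apply: distinct; [by case/tP: (tsP s)|by case/tP: (tsP s')|].
    by rewrite !(tnth_nth 0%N) nth_uniq.
  case/negP; apply/eqP; apply/idP/idP => xP; have [_ _ _ inP] := ptP s;
    have [_ _ _ inP'] := ptP s'.
  - by apply/inP' => i; rewrite -(eqP (negPn (E i))); apply: (inP x).1.
  - by apply/inP => i; rewrite (eqP (negPn (E i))); apply: (inP' x).1.
have ptJ s j : j \in J -> tnth (pt s) j = 'X_j by case: (ptP s) => H _ _ _; apply: H.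
have ptN s i : i \notin J ->
    supp_in (fun b => on_vars J b && lem b U_(i)%MM) (tnth (pt s) i).
  by case: (ptP s) => _ H _ _; apply: H.
(* [h] is a product of polynomials with leading exponent in [N^J], one for each plane of another
   type. *)
have [h [c0 [hv hl hc]]] : exists h c0, [/\
    vanishes_on (fun x => exists2 P, P \in ps /\ ~ min_free_vars P J & in_aplane P x) h,
    has_lead lem h c0 & on_vars J c0].
  elim: (ps) => [|P r [h [c0 [hv hl hc]]]].
    exists 1, 0%MM; split; [by move=> x [P []]| |exact: on_vars0].
    by split=> [|b]; rewrite msupp1 inE // => /eqP ->; apply: mo_refl.
  case: (classic (min_free_vars P J)) => mP.
    exists h, c0; split=> // x [Q [+ nQ] xQ]; rewrite inE => /predU1P[QP|Qr].
      by case: nQ; rewrite QP.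
    by apply: hv; exists Q.
  have [p [a [pv pl aJ]]] := non_min_free_vars_lead leo leU cJ mP.
  exists (p * h), (a + c0)%MM; split; [|exact: has_leadM|exact: on_varsD].
  move=> x [Q [+ nQ] xQ]; rewrite inE mevalM => /predU1P[QP|Qr].
    by rewrite pv ?mul0r // -QP.
  by rewrite hv ?mulr0 //; exists Q.
have van_A p : vanishing pt p -> vanishes_on A (p * h).
  move=> pv x /hasP[P Pps xP]; rewrite mevalM.
  case: (classic (min_free_vars P J)) => mP; last first.
    by rewrite (hv x) ?mulr0 //; exists P.
  have it : index P ps \in t by apply/tP; rewrite index_mem nth_index.
  have st : (index (index P ps) t < size t)%N by rewrite index_mem.
  have [_ _ van _] := ptP (Ordinal st); have := (van p).1 (pv _) x.
  by rewrite (tnth_nth 0%N) /= nth_index // nth_index // => ->; rewrite ?mul0r.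
have van_pt p : vanishes_on A p -> vanishing pt p.
  move=> pA s; have [_ _ van _] := ptP s; apply/van => x xP; apply: pA.
  apply/hasP; exists (plane s) => //; apply: mem_nth; by case/tP: (tsP s).
(* [I(A)] lies in the ideal of the planes of type [J], and multiplication by [h] leads back,
   shifting leading exponents only along [N^J]; so both give the same full exponents. *)
have dirP g : dplane_in (in_D le A) J g <-> full_dir lem J pt (mnm_of_exps g).
  split=> [[g0 gD]|[g0 gD]]; split.
  - by apply/on_vars_mnm => i; rewrite inE negbK; apply: g0.
  - move=> c p cJ' pv pl; apply: (gD (exps_of_mnm (c + c0)%MM)).
      by apply/on_vars_mnm; rewrite exps_of_mnmK; apply: on_varsD.
    apply/in_CP; exists (p * h); split; first exact: van_A.
    by rewrite mnm_of_expsD exps_of_mnmK addmA; apply: has_leadM.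
  - by move=> j jJ; move/on_vars_mnm: g0; apply; rewrite inE jJ.
  - move=> c /on_vars_mnm cJ' /in_CP[p [pA]]; rewrite mnm_of_expsD.
    by apply: gD => //; apply: van_pt.
apply: has_card_squeeze => [s us sP|s lts].
  rewrite -(size_map (@mnm_of_exps n)); apply: (size_full_dir kinf leo ptJ ptN).
    by rewrite map_inj_uniq //; apply: can_inj (@mnm_of_expsK n).
  by move=> m /mapP[g /sP /dirP gP ->].
have [|g gP gs] := exists_full_dir_notin leo ptJ ptN pt_sep (sg := map (@mnm_of_exps n) s).
  by rewrite size_map.
exists (exps_of_mnm g); first by apply/dirP; rewrite exps_of_mnmK.
by apply: contra gs => gs; apply/mapP; exists (exps_of_mnm g); rewrite ?exps_of_mnmK.
Qed.
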